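(* Let $r$ and $d$ be positive integers. Suppose that $G$ is a graph on $n>\frac{27}{8}dr^2$ vertices, having maximum degree less than $d$. Then $G$ is $r$-EKR.
   Context: All graphs are finite and simple. For a graph $G$, $\mathcal{I}^r(G)$ denotes the family of independent sets of $G$ of size exactly $r$, and for a vertex $v$, $s_r(v)$ denotes the number of members of $\mathcal{I}^r(G)$ containing $v$. A family of sets is intersecting if every two of its members intersect. $G$ is called $r$-EKR if, letting $\mathcal{F}\subseteq \mathcal{I}^r(G)$ be an intersecting subfamily of maximum size, some vertex $v$ satisfies $s_r(v)=|\mathcal{F}|$ (i.e. the maximum size of an intersecting subfamily of $\mathcal{I}^r(G)$ is attained by the family of all independent $r$-sets containing some fixed vertex). *)

(* Defs.v *)
(* A finite simple graph on a finType T is a symmetric and irreflexive adjacency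
   relation e : rel T. *)
From mathcomp Require Export all_boot all_order all_algebra.

Set Implicit Arguments.
Unset Strict Implicit.
Unset Printing Implicit Defensive.

Section EKR.

Variables (T : finType) (e : rel T).

Definition degree (v : T) : nat := #|[set w | e v w]|.

Definition max_degree : nat := \max_(v : T) degree v.

Definition independent (A : {set T}) : bool :=
  [forall x in A, forall y in A, ~~ e x y].

Definition indep_sets (r : nat) : {set {set T}} :=
  [set A : {set T} | independent A & #|A| == r].

Definition star_size (r : nat) (v : T) : nat :=
  #|[set A in indep_sets r | v \in A]|.

(* A = B is not excluded, so set0 belongs to no intersecting family; on families
   of r-sets with 0 < r this agrees with the condition on distinct members. *)
Definition intersecting (F : {set {set T}}) : Prop :=
  forall A B : {set T}, A \in F -> B \in F -> A :&: B != set0.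

Definition max_intersecting (r : nat) (F : {set {set T}}) : Prop :=
  [/\ F \subset indep_sets r, intersecting F &
      forall F' : {set {set T}},
        F' \subset indep_sets r -> intersecting F' -> #|F'| <= #|F|].

(* Since set0 is an intersecting family, some F satisfies max_intersecting r,
   so the universal quantifier over F is never vacuous. *)
Definition is_EKR (r : nat) : Prop :=
  forall F : {set {set T}}, max_intersecting r F ->
    exists v : T, star_size r v = #|F|.

End EKR.

(* Main.v *)
(** Write s(S) for the number of independent r-sets containing S.  Replacing w
    by an arbitrary vertex outside the closed neighbourhood of the remaining
    r - 1 vertices gives (n - (r - 1) d) s(S + w) <= (r - 1) s(S) for nonempty
    S, hence 2 r s(S + w) <= s(S) in the given range of n.  Let F be an
    intersecting family and C a cover (a set meeting every member of F) of
    minimum size t.  Every set S with |S| < t misses some A in F, and the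
    members of F containing S meet A; branching over the r elements of A
    halves the bound at each step, so a vertex x lies in at most
    s(x) / 2^(t - 1) members of F.  Summing over x in C gives
    |F| <= t / 2^(t - 1) max s <= max s. *)
Require Import Defs.
From mathcomp Require Import all_boot all_order all_algebra.
From mathcomp Require Import zify lra.
Import GRing.Theory Num.Theory.

Set Implicit Arguments.
Unset Strict Implicit.
Unset Printing Implicit Defensive.

Section Containing.

Variables (T : finType) (F : {set {set T}}).

Definition containing (S : {set T}) : {set {set T}} :=
  [set A in F | S \subset A].

Definition cover_of (S : {set T}) : bool :=
  [forall A in F, A :&: S != set0].

(** A union bound over a point of [B :&: A]. It serves twice: with a member of the family as [A] it
    is the branching step, with a cover as [A] and [S] empty it starts the branching. *)
Lemma card_le_sum_containing (G : {set {set T}}) (S A : {set T}) :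
  G \subset containing S -> (forall B, B \in G -> B :&: A != set0) ->
  #|G| <= \sum_(w in A) #|containing (w |: S)|.
Proof.
move=> sGF GA.
suff sub : G \subset \bigcup_(w in A) containing (w |: S).
  apply: leq_trans (subset_leq_card sub) _.
  elim/big_rec2: _ => [|w n U _ le_Un]; first by rewrite cards0.
  by rewrite (leq_trans (leq_card_setU _ _)) // leq_add2l.
apply/subsetP => B BG; have /set0Pn[w] := GA _ BG.
rewrite inE => /andP[wB wA]; apply/bigcupP; exists w => //.
have := subsetP sGF _ BG; rewrite !inE => /andP[-> SB] /=.
by rewrite subUset sub1set wB.
Qed.

End Containing.

Section Swap.

Variables (T : finType) (e : rel T) (r d : nat).
Hypotheses (e_sym : symmetric e) (e_irr : irreflexive e).
Hypothesis deg_lt : max_degree e < d.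

Definition closed_nbhd (A : {set T}) : {set T} :=
  \bigcup_(v in A) (v |: [set w | e v w]).

Lemma card_closed_nbhd (A : {set T}) : #|closed_nbhd A| <= #|A| * d.
Proof.
rewrite -sum_nat_const /closed_nbhd.
elim/big_rec2: _ => [|v n U _ le_Un]; first by rewrite cards0.
rewrite (leq_trans (leq_card_setU _ _)) // leq_add //.
rewrite (leq_trans (leq_card_setU _ _)) // cards1 add1n.
by apply: leq_ltn_trans deg_lt; apply: (leq_bigmax (F := degree e) v).
Qed.

Lemma independentP (A : {set T}) :
  reflect {in A &, forall x y, ~~ e x y} (independent e A).
Proof.
apply: (iffP forall_inP) => H x; first by move=> y /H/forall_inP; apply.
by move=> xA; apply/forall_inP => y; apply: H.
Qed.

Lemma independent_setU1 (x : T) (A : {set T}) :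
  independent e A -> x \notin closed_nbhd A -> independent e (x |: A).
Proof.
move=> /independentP indA /bigcupP xA.
have far y : y \in A -> ~~ e y x.
  by move=> yA; apply/negP => eyx; case: xA; exists y => //; rewrite !inE eyx orbT.
apply/independentP => y z /setU1P[->|yA] /setU1P[->|zA].
- by rewrite e_irr.
- by rewrite e_sym far.
- exact: far.
- exact: indA.
Qed.

Lemma notin_closed_nbhd (x : T) (A : {set T}) :
  x \notin closed_nbhd A -> x \notin A.
Proof.
by apply: contra => xA; apply/bigcupP; exists x => //; rewrite setU11.
Qed.

Lemma independent_sub (A B : {set T}) :
  A \subset B -> independent e B -> independent e A.
Proof.
move=> /subsetP sAB /independentP indB.
by apply/independentP => x y /sAB xB /sAB; apply: indB.
Qed.

(** Double counting: the pairs in [P], at least |T| - (r-1)d for each set through [w |: S], inject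
    into [Q], where each set has at most r-1 points outside the nonempty [S]. *)
Lemma containing_swap (S : {set T}) (w : T) :
  S != set0 -> w \notin S ->
  #|containing (indep_sets e r) (w |: S)| * (#|T| - r.-1 * d)
    <= #|containing (indep_sets e r) S| * r.-1.
Proof.
move=> S0 wS.
pose P := [set p : {set T} * T | (p.1 \in containing (indep_sets e r) (w |: S))
             && (p.2 \in ~: closed_nbhd (p.1 :\ w))].
pose Q := [set p : {set T} * T | (p.1 \in containing (indep_sets e r) S)
             && (p.2 \in p.1 :\: S)].
(* Keeping the new vertex as second component makes the map injective: removing it and restoring the
   fixed [w] recovers the original set. *)
pose swap (p : {set T} * T) := (p.2 |: (p.1 :\ w), p.2).
have cardE (G : {set {set T}}) (H : {set T} -> {set T}) :
    #|[set p : {set T} * T | (p.1 \in G) && (p.2 \in H p.1)]|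
      = \sum_(A in G) #|H A|.
  rewrite -sum1_card (eq_bigl (fun p => (p.1 \in G) && (p.2 \in H p.1))).
    rewrite -(pair_big_dep (fun A => A \in G) (fun A x => x \in H A)
                (fun _ _ => 1)) /=.
    by apply: eq_bigr => A _; rewrite sum1_card.
  by move=> p; rewrite inE.
have leP : #|containing (indep_sets e r) (w |: S)| * (#|T| - r.-1 * d) <= #|P|.
  rewrite (cardE _ (fun A => ~: closed_nbhd (A :\ w))) -sum_nat_const; apply: leq_sum => A.
  rewrite !inE subUset sub1set => /andP[/andP[_ /eqP cA] /andP[wA _]].
  rewrite cardsCs setCK leq_sub2l //.
  apply: leq_trans (card_closed_nbhd _) _.
  by have := cardsD1 w A; rewrite wA cA add1n => ->.
have leQ : #|Q| <= #|containing (indep_sets e r) S| * r.-1.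
  rewrite (cardE _ (fun A => A :\: S)) -sum_nat_const; apply: leq_sum => A.
  rewrite !inE => /andP[/andP[_ /eqP cA] SA].
  rewrite cardsD (setIidPr SA) cA.
  by move: S0; rewrite -card_gt0; lia.
apply: leq_trans leP _; apply: leq_trans leQ.
have swap_inj : {in P &, injective swap}.
  have K A x : (A, x) \in P -> A = w |: ((x |: (A :\ w)) :\ x).
    rewrite !inE /= subUset sub1set => /andP[/andP[_ /andP[wA _]]].
    by move=> /notin_closed_nbhd xA; rewrite setU1K // setD1K.
  move=> [A x] [B y] /K AE /K BE [EAB xy]; move: AE BE.
  by rewrite EAB xy => {1}-> <-.
rewrite -(card_in_imset swap_inj); apply: subset_leq_card.
apply/subsetP => _ /imsetP[[A x] + ->].
rewrite !inE /= !subUset !sub1set.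
move=> /andP[/andP[/andP[indA /eqP cA] /andP[wA SA]] farx].
have xA := notin_closed_nbhd farx.
have SAw : S \subset A :\ w by rewrite subsetD1 SA.
rewrite independent_setU1 ?(independent_sub (subD1set A w)) //=.
rewrite cardsU1 xA -cA (cardsD1 w A) wA eqxx /= eqxx /= andbT.
rewrite (subset_trans SAw (subsetUr _ _)) /=.
by apply: contra xA => /(subsetP SAw).
Qed.

(** Chosen so that cancelling r-1 in [containing_swap] leaves the factor 2r; written as a sum to
    avoid truncated subtraction. *)
Hypothesis card_T_ge : 2 * r * r.-1 + r.-1 * d <= #|T|.

Lemma containing_halve (S : {set T}) (w : T) :
  S != set0 -> w \notin S ->
  2 * r * #|containing (indep_sets e r) (w |: S)|
    <= #|containing (indep_sets e r) S|.
Proof.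
move=> S0 wS; have := containing_swap S0 wS.
(* Cancelling r-1 requires r > 1; for smaller r, no r-set contains the at least two points of
   [w |: S]. *)
have [r1 _|r1 le_sw] := leqP r 1.
  suff -> : containing (indep_sets e r) (w |: S) = set0 by rewrite cards0 muln0.
  apply/setP => A; rewrite !inE; apply/negP => /andP[/andP[_ /eqP cA]].
  move=> /subset_leq_card; rewrite cardsU1 wS cA.
  by move: S0; rewrite -card_gt0; lia.
have r0 : 0 < r.-1 by lia.
rewrite -(leq_pmul2r r0); apply: leq_trans le_sw.
by rewrite mulnAC mulnC leq_mul2l; lia.
Qed.

Variable F : {set {set T}}.
Hypotheses (F_indep : F \subset indep_sets e r) (F_int : intersecting F).

(** Induction on [k], a gap between |S| and the size of every cover. Each of the r branches gains 2r
    from [containing_halve], so a factor 2 survives the summation. *)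
Lemma containing_below_cover (k : nat) (S : {set T}) :
  S != set0 -> (forall C, cover_of F C -> #|S| + k <= #|C|) ->
  2 ^ k * #|containing F S| <= #|containing (indep_sets e r) S|.
Proof.
elim: k S => [|k IHk] S S0 minS.
  rewrite expn0 mul1n subset_leq_card //; apply/subsetP => A.
  by rewrite !inE => /andP[/(subsetP F_indep) + ->]; rewrite !inE => ->.
have /forall_inPn[A AF] : ~~ cover_of F S.
  by apply/negP => /minS; lia.
rewrite negbK => /eqP AS0.
have cA : #|A| = r.
  by have := subsetP F_indep _ AF; rewrite inE => /andP[_ /eqP].
have r0 : 0 < r.
  by rewrite -cA card_gt0; have := F_int AF AF; rewrite setIid.
have le_sum : #|containing F S| <= \sum_(w in A) #|containing F (w |: S)|.
  apply: card_le_sum_containing => // B.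
  by rewrite inE => /andP[BF _]; apply: F_int.
(* Multiplying by r = |A| turns the right side into a constant sum over [A], to be compared term by
   term. *)
rewrite -(leq_pmul2l r0) -[X in _ <= X * _]cA -sum_nat_const.
apply: (@leq_trans (\sum_(w in A) 2 * r * (2 ^ k * #|containing F (w |: S)|))).
  rewrite -!big_distrr /= expnS.
  by rewrite [2 * r]mulnC -!mulnA !leq_mul2l le_sum !orbT.
apply: leq_sum => w wA.
have wS : w \notin S.
  by apply/negP => wS; move/setP/(_ w): AS0; rewrite !inE wA wS.
apply: leq_trans (containing_halve S0 wS); rewrite leq_mul2l IHk ?orbT //.
  by apply/set0Pn; exists w; rewrite setU11.
by move=> C /minS; rewrite cardsU1 wS; lia.
Qed.

Lemma intersecting_le_star (m : nat) :
  (forall v, star_size e r v <= m) -> #|F| <= m.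
Proof.
move=> le_m.
have star v : #|containing (indep_sets e r) [set v]| <= m.
  apply: leq_trans (le_m v); rewrite subset_leq_card //.
  by apply/subsetP => A; rewrite !inE sub1set.
have covT : cover_of F setT.
  by apply/forall_inP => A AF; rewrite setIT -[A]setIid F_int.
case: (arg_minnP (fun C : {set T} => #|C|) covT) => C covC minC.
have le_sum : #|F| <= \sum_(w in C) #|containing F [set w]|.
  under eq_bigr do rewrite -(setU0 [set _]).
  apply: card_le_sum_containing => [|B BF]; last exact: (forall_inP covC).
  by apply/subsetP => B; rewrite inE sub0set andbT.
(* An empty cover forces [F] to be empty; otherwise |C| can be cancelled. *)
have [C0|C0] := posnP #|C|.
  by move: le_sum; rewrite (cards0_eq C0) big_set0 leqn0 => /eqP->.
have lt2 : #|C| <= 2 ^ #|C|.-1.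
  by apply: leq_trans (ltn_expl #|C|.-1 (ltnSn 1)); lia.
rewrite -(leq_pmul2l C0); apply: leq_trans (leq_mul lt2 le_sum) _.
rewrite big_distrr -sum_nat_const /=; apply: leq_sum => w _.
(* A singleton leaves the gap k = |C| - 1 to the minimum cover. *)
apply: leq_trans (star w); apply: containing_below_cover.
  by apply/set0Pn; exists w; rewrite inE.
by move=> D /minC; rewrite cards1; lia.
Qed.

End Swap.

Lemma intersecting_star (T : finType) (e : rel T) (r : nat) (v : T) :
  intersecting [set A in indep_sets e r | v \in A].
Proof.
move=> A B; rewrite !inE => /andP[_ vA] /andP[_ vB].
by apply/set0Pn; exists v; rewrite inE vA.
Qed.

Theorem theorem2p1 (r d : nat) (T : finType) (e : rel T) :
  0 < r -> 0 < d ->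
  symmetric e -> irreflexive e ->
  (27%:R / 8%:R * d%:R * r%:R ^+ 2 < #|T|%:R :> rat)%R ->
  max_degree e < d ->
  is_EKR e r.
Proof.
move=> r0 d0 e_sym e_irr lt_n deg_lt F [F_indep F_int F_max].
have lt_nat : 27 * d * r ^ 2 < 8 * #|T|.
  by rewrite -(ltr_nat rat) !natrM; lra.
(* As d and r are positive, 16r(r-1) + 8(r-1)d <= 24dr^2 <= 27dr^2 < 8|T|. *)
have card_T_ge : 2 * r * r.-1 + r.-1 * d <= #|T|.
  by case: r r0 lt_nat {lt_n F_indep F_max} => // r _; nia.
have /card_gt0P[v0 _] : 0 < #|T| by lia.
case: (@arg_maxnP T v0 predT (star_size e r) isT) => v _ max_v.
exists v; apply/eqP; rewrite eqn_leq; apply/andP; split.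
  apply: F_max; last exact: intersecting_star.
  by apply/subsetP => A; rewrite inE => /andP[].
apply: (@intersecting_le_star T e r d) => // w.
exact: max_v.
Qed.
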